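(* Let $\mathbf A\in\{0,1\}^{n\times n}$ be positive semidefinite. Then for any $\epsilon\in(0,1)$, any (possibly adaptive) deterministic algorithm which approximates all eigenvalues of $\mathbf A$ up to $\epsilon n$ additive error must read $\Omega(n/\epsilon)$ entries of $\mathbf A$.
   Formalization: Proved for ε ≤ ε₀ with any fixed ε₀ < 1/2 (constant depends only on ε₀) and n ≥ 1/ε: for ε ≥ 1/2 the constant output n/2 needs no reads, no uniform constant works as ε → 1/2, and for εn → 0 the bound exceeds the n² entries. *)

(* Defs.v *)
From HB Require Import structures.
From mathcomp Require Import all_boot all_order all_algebra.
From mathcomp Require Import reals.

Set Implicit Arguments.
Unset Strict Implicit.
Unset Printing Implicit Defensive.

Import Order.TTheory GRing.Theory Num.Theory.

Local Open Scope ring_scope.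

Definition binarymx (R : realType) (n : nat) (A : 'M[R]_n) : Prop :=
  forall i j : 'I_n, A i j = 0 \/ A i j = 1.

Definition psdmx (R : realType) (n : nat) (A : 'M[R]_n) : Prop :=
  A \is symmetricmx /\ forall x : 'cV[R]_n, 0 <= (x^T *m A *m x) 0 0.

(* The eigenvalues with algebraic multiplicity, in nonincreasing order. Such an
   [s] is unique, has size [n], and exists whenever [A] is symmetric. *)
Definition is_spectrum (R : realType) (n : nat) (A : 'M[R]_n) (s : seq R) :
    Prop :=
  sorted >=%R s /\ char_poly A = \prod_(a <- s) ('X - a%:P).

(* Approximations are matched with the sorted eigenvalues; if they are seen as
   an unordered list, sorting them minimizes the largest error. *)
Definition approx_spectrum (R : realType) (n : nat) (delta : R)
    (A : 'M[R]_n) (v : 'rV[R]_n) : Prop :=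
  forall s : seq R, is_spectrum A s ->
    forall i : 'I_n, `|v 0 i - s`_i| <= delta.

(* A deterministic adaptive algorithm on n x n inputs, as a decision tree:
   either it stops with an output, or it reads the entry (i, j) and continues
   in a way that may depend on the value found there (hence on all the values
   read so far). Only reads are counted; computation is unrestricted. *)
Inductive algorithm (R : realType) (n : nat) : Type :=
| Output of 'rV[R]_n
| Read (i j : 'I_n) of (R -> algorithm R n).

Fixpoint run (R : realType) (n : nat) (alg : algorithm R n) (A : 'M[R]_n) :
    'rV[R]_n :=
  match alg with
  | Output v => v
  | Read i j k => run (k (A i j)) A
  end.

Fixpoint entries_read (R : realType) (n : nat) (alg : algorithm R n)
    (A : 'M[R]_n) : {set 'I_n * 'I_n} :=
  match alg with
  | Output _ => set0
  | Read i j k => (i, j) |: entries_read (k (A i j)) A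
  end.

Definition approximates_psd_spectra (R : realType) (n : nat) (eps : R)
    (alg : algorithm R n) : Prop :=
  forall A : 'M[R]_n, binarymx A -> psdmx A ->
    approx_spectrum (eps * n%:R) A (run alg A).

(* Main.v *)
(* Adversary argument. A 0/1 matrix that is a scalar matrix except for an
   all-ones block on an index set S has largest eigenvalue #|S|, so an accurate
   algorithm run on a scalar matrix must read an entry of S x S as soon as
   #|S| exceeds about 2 eps n. For eps <= 1/6 use the identity: the off-diagonal
   entries read form a graph without independent sets of size about 3 eps n,
   which by a Turan-type bound has at least about n / eps edges. For larger eps
   the zero matrix suffices: the complement of the rows read is a valid S, so at
   least (1 - 2 eps) n rows are read. *)
Require Import Defs.
From mathcomp Require Import all_boot all_order all_algebra.
From mathcomp Require Import reals.
From mathcomp Require Import ring lra.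

Set Implicit Arguments.
Unset Strict Implicit.
Unset Printing Implicit Defensive.

Import Order.TTheory GRing.Theory Num.Theory.

Local Open Scope ring_scope.

(** * Independent sets in sparse graphs *)

Definition neighbors (T : finType) (E : {set T * T}) (v : T) : {set T} :=
  [set w | ((v, w) \in E) || ((w, v) \in E)].

(** Loops are ignored: reading a diagonal entry of the identity reveals nothing about a clique on
    [S]. *)
Definition independent (T : finType) (E : {set T * T}) (S : {set T}) : bool :=
  [forall v in S, forall w in S, (v != w) ==> ((v, w) \notin E)].

Lemma independentP (T : finType) (E : {set T * T}) (S : {set T}) :
  reflect {in S &, forall v w, v != w -> (v, w) \notin E} (independent E S).
Proof.
apply: (iffP forall_inP) => [indS v w Sv Sw | indS v Sv].
  by move=> neq; have/forall_inP/(_ w Sw)/implyP := indS v Sv; apply.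
by apply/forall_inP=> w Sw; apply/implyP; apply: indS.
Qed.

(** Each pair of [E] contributes at most one neighbor to each of its two ends; loops and reversed
    pairs only lose. *)
Lemma sum_card_neighbors (T : finType) (E : {set T * T}) :
  (\sum_v #|neighbors E v| <= 2 * #|E|)%N.
Proof.
have cardE : (\sum_v \sum_(w | (v, w) \in E) 1 = #|E|)%N.
  rewrite pair_big_dep /= -sum1_card.
  by apply: eq_bigl => -[].
have cardE' : (\sum_v \sum_(w | (w, v) \in E) 1 = #|E|)%N.
  by rewrite -cardE (exchange_big_dep predT).
rewrite mul2n -addnn -{1}cardE -cardE' -big_split /=.
apply: leq_sum => v _.
rewrite !sum1_card -(cardsE [pred w | (v, w) \in E]).
rewrite -(cardsE [pred w | (w, v) \in E]).
apply: leq_trans (leq_card_setU _ _).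
by apply: subset_leq_card; apply/subsetP=> w; rewrite !inE.
Qed.

(* A maximal independent set among the vertices of degree less than [t]
   dominates all of them, and Markov's inequality bounds the number of the
   others. *)
Lemma ex_large_independent (T : finType) (E : {set T * T}) (t : nat) :
  exists2 S : {set T}, independent E S &
    (#|T| * t <= #|S| * t ^ 2 + 2 * #|E|)%N.
Proof.
pose L := [set v | #|neighbors E v| < t]%N.
have [S maxS _] :
    {S | maxset (fun S => independent E S && (S \subset L)) S & set0 \subset S}.
  apply: maxset_exists; rewrite sub0set andbT.
  by apply/independentP=> v w; rewrite inE.
have /andP[indS subS] := maxsetp maxS.
exists S => //.
have high : (#|~: L| * t <= 2 * #|E|)%N.
  apply: leq_trans (sum_card_neighbors E).
  rewrite -sum_nat_const big_mkcond /=.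
  apply: leq_sum => v _; rewrite !inE -leqNgt.
  by case: ifP.
have dom : L \subset \bigcup_(v in S) (v |: neighbors E v).
  apply/subsetP=> w Lw; apply: contraT => nw.
  have nwS v : v \in S -> (w != v) && (w \notin neighbors E v).
    move=> Sv; rewrite -negb_or; apply: contra nw => wv.
    by apply/bigcupP; exists v => //; rewrite in_setU1.
  have : w |: S = S.
    apply: (maxsetsup maxS); last exact: subsetUr.
    rewrite /= subUset sub1set Lw subS !andbT.
    apply/independentP=> v1 v2 /setU1P[->|S1] /setU1P[->|S2] ne.
    - by rewrite eqxx in ne.
    - by have /andP[_] := nwS _ S2; rewrite !inE negb_or => /andP[].
    - by have /andP[_] := nwS _ S1; rewrite !inE negb_or => /andP[].
    - by move/independentP: indS; apply.
  move=> wS; have : w \in S by rewrite -wS setU11.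
  by move/nwS; rewrite eqxx.
(* Each vertex of [S] dominates itself and fewer than [t] neighbors, hence at most [t] vertices. *)
have low : (#|L| <= #|S| * t)%N.
  apply: leq_trans (subset_leq_card dom) _.
  rewrite -sum_nat_const.
  apply: leq_trans (_ : \sum_(v in S) #|v |: neighbors E v| <= _)%N.
    elim/big_rec2: _ => [|v m A _ le]; first by rewrite cards0.
    by apply: leq_trans (leq_card_setU _ _) _; rewrite leq_add2l.
  apply: leq_sum => v Sv; have := subsetP subS v Sv; rewrite inE => lt.
  apply: leq_trans lt; rewrite cardsU1; by case: (_ \notin _).
rewrite -(cardsC L) mulnDl; apply: leq_add => //.
by rewrite expnS expn1 mulnA leq_mul2r low orbT.
Qed.

(** * Runs on indistinguishable inputs *)

Lemma run_agree (R : realType) (n : nat) (alg : algorithm R n) (A B : 'M[R]_n) :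
  {in entries_read alg A, forall e, A e.1 e.2 = B e.1 e.2} ->
  run alg A = run alg B.
Proof.
elim: alg => [//|i j k IHk] /= agree.
have eqAB : A i j = B i j := agree (i, j) (setU11 _ _).
rewrite -eqAB; apply: IHk => e eA.
by apply: agree; rewrite setU1r.
Qed.

(** * Spectra of clique matrices *)

(* Clear the lower left, respectively the upper right, block of the matrix with
   blocks [M, -u; v, 1]; the form with [a] on the left avoids dividing by it. *)
Lemma det_rank1_update (R : comNzRingType) (n : nat) (M : 'M[R]_n)
    (u : 'cV[R]_n) (v : 'rV[R]_n) (a : R) :
  M *m u = a *: u ->
  \det (M + u *m v) * a = \det M * (a + (v *m u) 0 0).
Proof.
move=> Mu.
pose B := block_mx M (- u) v (1%:M : 'M_1).
have detB : \det B = \det (M + u *m v).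
  have -> : \det B = \det (B *m block_mx 1%:M 0 (- v) 1%:M).
    by rewrite det_mulmx det_lblock !det1 !mulr1.
  rewrite mulmx_block !mulmx1 !mulmx0 mulNmx mulmxN opprK mul1mx addrN !add0r.
  by rewrite det_ublock det1 mulr1.
rewrite -detB.
have detC : \det (block_mx 1%:M u 0 (a%:M : 'M_1)) = a.
  by rewrite det_ublock det1 mul1r det_scalar1.
rewrite -[X in _ * X = _]detC -det_mulmx mulmx_block !mulmx1 !mulmx0 !addr0 Mu mul_mx_scalar.
rewrite scalerN addrN det_lblock mul1mx; congr (_ * _).
by rewrite det_mx11 !mxE eqxx mulr1n addrC.
Qed.

(* The disjoint union of the clique [S] and of isolated vertices, which carry a
   loop when [d] holds. *)
Definition cliquemx (R : realType) (n : nat) (d : bool) (S : {set 'I_n}) :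
    'M[R]_n :=
  \matrix_(i, j) ((i \in S) && (j \in S) || (i == j) && d)%:R.

Definition indicator (R : pzRingType) (n : nat) (S : {set 'I_n}) : 'cV[R]_n :=
  \col_i (i \in S)%:R.

(** Nonnegative diagonal plus rank one: the first makes the quadratic form a sum of squares, the
    second makes the characteristic polynomial a rank-one update. *)
Lemma cliquemxE (R : realType) (n : nat) (d : bool) (S : {set 'I_n}) :
  cliquemx R d S = diag_mx (\row_i (d && (i \notin S))%:R)
                   + indicator R S *m (indicator R S)^T.
Proof.
apply/matrixP=> i j; rewrite !mxE big_ord1 !mxE.
case: (eqVneq i j) => [<-|_]; rewrite ?mulr1n ?mulr0n.
  by case: (i \in S); case: d; rewrite /= ?mulr1 ?mulr0 ?addr0 ?add0r.
by case: (i \in S); case: (j \in S); rewrite /= ?mulr1 ?mulr0 ?addr0 ?add0r.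
Qed.

Lemma cliquemx_binary (R : realType) (n : nat) (d : bool) (S : {set 'I_n}) :
  binarymx (cliquemx R d S).
Proof. by move=> i j; rewrite mxE; case: (_ || _); [right | left]. Qed.

Lemma cliquemx_psd (R : realType) (n : nat) (d : bool) (S : {set 'I_n}) :
  psdmx (cliquemx R d S).
Proof.
split.
  apply/is_hermitianmxP; rewrite expr0 scale1r map_mx_id //.
  by apply/matrixP=> i j; rewrite !mxE eq_sym andbC.
move=> x; rewrite cliquemxE mulmxDr mulmxDl mxE addr_ge0 //.
  rewrite mxE sumr_ge0 // => i _.
  rewrite mul_mx_diag !mxE mulrAC -expr2 mulr_ge0 ?sqr_ge0 //.
rewrite mulmxA -(mulmxA (_ *m _)) -{1}[indicator R S]trmxK -trmx_mul.
by rewrite mxE big_ord1 mxE -expr2 sqr_ge0.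
Qed.

(** The diagonal part of the characteristic matrix is ['X] on [S], so the indicator of [S] is an
    eigenvector for ['X] and [det_rank1_update] applies with [a = 'X]; the extra factor ['X] is then
    cancelled. *)
Lemma char_poly_cliquemx (R : realType) (n : nat) (d : bool) (S : {set 'I_n}) :
  (0 < #|S|)%N ->
  char_poly (cliquemx R d S)
  = ('X - #|S|%:R%:P) * ('X - d%:R%:P) ^+ (n - #|S|) * 'X ^+ #|S|.-1.
Proof.
move=> S_gt0.
pose M : 'M[{poly R}]_n := diag_mx (\row_i ('X - (d && (i \notin S))%:R%:P)).
pose u := indicator {poly R} S.
have charE : char_poly_mx (cliquemx R d S) = M + u *m (- u^T).
  apply/matrixP=> i j; rewrite cliquemxE !mxE !big_ord1 !mxE rmorphD rmorphM /=.
  rewrite mulrN !rmorph_nat opprD addrA; congr (_ - _).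
  by case: (i == j); rewrite ?mulr1n ?mulr0n ?subr0 ?rmorph_nat // polyC0 subr0.
have Mu : M *m u = 'X *: u.
  apply/matrixP=> i j; rewrite mul_diag_mx !mxE.
  by case: (i \in S); rewrite ?mulr0 // andbF subr0.
have uu : ((- u^T) *m u) 0 0 = - #|S|%:R%:P.
  rewrite mulNmx !mxE rmorph_nat -sum1_card natr_sum [in RHS]big_mkcond /=.
  congr (- _); apply: eq_bigr => i _; rewrite !mxE.
  by case: ifP; rewrite ?mulr1 ?mulr0.
have detM : \det M = ('X - d%:R%:P) ^+ (n - #|S|) * 'X ^+ #|S|.
  rewrite det_diag (bigID (mem S)) /= mulrC; congr (_ * _).
    rewrite (eq_bigr (fun _ => 'X - d%:R%:P)) => [|i nS]; last by rewrite mxE nS andbT.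
    rewrite prodr_const -[in RHS](setCK S) -[n in (n - _)%N]card_ord -cardsCs.
    by congr (_ ^+ _); apply: eq_card => i; rewrite inE.
  rewrite (eq_bigr (fun _ => 'X)) ?prodr_const // => i Si.
  by rewrite mxE Si andbF subr0.
apply: (mulIf (_ : 'X != 0)); first by rewrite polyX_eq0.
rewrite /char_poly charE det_rank1_update // uu detM.
by rewrite -[RHS]mulrA -exprSr prednK // -[RHS]mulrA mulrC.
Qed.

Lemma cliquemx_spectrum (R : realType) (n : nat) (d : bool) (S : {set 'I_n}) :
  (0 < #|S|)%N ->
  is_spectrum (cliquemx R d S)
    (#|S|%:R :: nseq (n - #|S|) d%:R ++ nseq #|S|.-1 0).
Proof.
move=> S_gt0; split; last first.
  rewrite char_poly_cliquemx // big_cons big_cat /= !big_nseq !iter_mulr_1.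
  by rewrite subr0 mulrA.
have d_le : d%:R <= #|S|%:R :> R by rewrite ler_nat (leq_trans (leq_b1 d)).
rewrite sorted_pairwise; last exact: rev_trans le_trans.
rewrite pairwise_cons pairwise_cat all_cat !all_nseq.
apply/and4P; split.
- by apply/andP; split; apply/orP; right; [exact: d_le | exact: ler0n].
- apply/allrelP=> x y; rewrite !mem_nseq => /andP[_ /eqP->] /andP[_ /eqP->].
  exact: ler0n.
- by elim: (n - _)%N => //= m ->; rewrite all_nseq andbT; apply/orP; right; exact: lexx.
- by elim: _.-1 => //= m ->; rewrite all_nseq andbT; apply/orP; right; exact: lexx.
Qed.

Lemma scalar_spectrum (R : realType) (n : nat) (a : R) :
  is_spectrum (a%:M : 'M_n) (nseq n a).
Proof.
split; first by case: n => //= n; elim: n => //= n ->; rewrite lexx.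
rewrite big_nseq iter_mulr_1 /char_poly /char_poly_mx map_scalar_mx -raddfB.
by rewrite det_scalar.
Qed.

Lemma cliquemx_set0 (R : realType) (n : nat) (d : bool) :
  cliquemx R d set0 = d%:R%:M :> 'M_n.
Proof.
apply/matrixP=> i j; rewrite !mxE !inE /=.
by case: (i == j); rewrite /= ?mulr1n ?mulr0n.
Qed.

(** * Lower bounds on the number of reads *)

(* Turning [S] into a clique must not go unnoticed if it moves the largest
   eigenvalue by more than twice the allowed error. *)
Lemma unread_card_le (R : realType) (n : nat) (eps : R) (alg : algorithm R n)
    (d : bool) (S : {set 'I_n}) :
  0 <= eps * n%:R -> approximates_psd_spectra eps alg ->
  {in S &, forall i j, (i, j) \in entries_read alg (cliquemx R d set0) ->
     d && (i == j)} ->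
  #|S|%:R <= d%:R + 2 * (eps * n%:R).
Proof.
move=> err_ge0 approx unread.
have [->|[i0 Si0]] := set_0Vmem S.
  by rewrite cards0 addr_ge0 ?ler0n // mulr_ge0.
have S_gt0 : (0 < #|S|)%N by rewrite (cardD1 i0) Si0.
have n_gt0 : (0 < n)%N by apply: leq_ltn_trans (ltn_ord i0).
pose top : 'I_n := Ordinal n_gt0.
have eq_run : run alg (cliquemx R d set0) = run alg (cliquemx R d S).
  (* An entry read inside [S] x [S] is diagonal with [d] true, so it is 1 in both matrices; outside,
     they coincide. *)
  apply: run_agree => -[i j] read /=; rewrite !mxE !inE /=.
  have [Si /=|//] := boolP (i \in S); have [Sj /=|//] := boolP (j \in S).
  by have /andP[-> ->] := unread i j Si Sj read.
have := approx _ (cliquemx_binary R d S) (cliquemx_psd R d S) _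
  (cliquemx_spectrum R d S_gt0) top.
have := approx _ (cliquemx_binary R d set0) (cliquemx_psd R d set0).
rewrite cliquemx_set0 => /(_ _ (scalar_spectrum n _) top).
rewrite -cliquemx_set0 eq_run nth_nseq n_gt0 /= !ler_norml.
by move=> /andP[_ h1] /andP[h2 _]; lra.
Qed.

Lemma identity_reads (R : realType) (n : nat) (eps : R) (alg : algorithm R n) :
  0 < eps -> eps <= 1 / 6 -> 1 <= eps * n%:R ->
  approximates_psd_spectra eps alg ->
  n%:R / eps <= 48 * #|entries_read alg (cliquemx R true set0)|%:R.
Proof.
move=> eps_gt0 eps_le err_ge1 approx.
set E := entries_read _ _.
(* As [#|S| <= 3 * eps * n] and [t <= x], the term [#|S| * t ^ 2] is at most [n * t / 2], leaving
   [n * t / 4 <= #|E|]. Rounding down [x >= 1] at most halves it, whence 48 = 6 * 2 * 4. *)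
pose x := (6 * eps)^-1; pose t := Num.truncn x.
have xe : x * eps = 1 / 6 by rewrite /x invfM -mulrA mulVf ?gt_eqF // mulr1 div1r.
have x_ge1 : 1 <= x by rewrite -[1]invr1 lef_pV2 ?posrE; lra.
have /andP[t_le lt_t] : t%:R <= x < t.+1%:R by apply: truncn_itv; lra.
have t_ge1 : (1 <= t)%N by rewrite truncn_gt0.
have [S /independentP indS] := ex_large_independent E t.
rewrite card_ord -(ler_nat R) natrD !natrM => size_S.
have card_S : #|S|%:R <= 1 + 2 * (eps * n%:R).
  apply: (@unread_card_le _ _ _ alg true) => //; first lra.
  by move=> i j Si Sj; apply: contraTT => /= ne; apply: indS.
move: lt_t t_ge1 size_S; rewrite -(ler_nat R) -natr1 -expr2 => lt_t t_ge1 size_S.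
have n_ge0 : 0 <= n%:R :> R by [].
have -> : n%:R / eps = 6 * n%:R * x.
  by rewrite /x invfM mulrACA divff ?mul1r ?pnatr_eq0.
have h1 : #|S|%:R * t%:R ^+ 2 <= 3 * (eps * n%:R) * t%:R ^+ 2.
  by apply: ler_wpM2r; [exact: sqr_ge0 | lra].
have h2 : t%:R * eps <= 1 / 6 by rewrite -xe ler_pM2r.
have h3 : t%:R * eps * (n%:R * t%:R) <= 1 / 6 * (n%:R * t%:R).
  by apply: ler_wpM2r => //; apply: mulr_ge0.
have h4 : n%:R * x <= n%:R * (2 * t%:R) by apply: ler_wpM2l => //; lra.
have e1 : 3 * (eps * n%:R) * t%:R ^+ 2 = 3 * (t%:R * eps * (n%:R * t%:R)) by ring.
lra.
Qed.

Lemma zero_reads (R : realType) (n : nat) (eps : R) (alg : algorithm R n) :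
  0 <= eps * n%:R -> approximates_psd_spectra eps alg ->
  (1 - 2 * eps) * n%:R <= #|entries_read alg (cliquemx R false set0)|%:R.
Proof.
move=> err_ge0 approx; set E := entries_read _ _.
pose rows := [set e.1 | e in E].
have : #|~: rows|%:R <= 0 + 2 * (eps * n%:R).
  apply: (@unread_card_le _ _ _ alg false) => // i j.
  rewrite inE => /imsetP notin _ read; case: notin.
  by exists (i, j).
have : #|rows|%:R <= #|E|%:R :> R by rewrite ler_nat leq_imset_card.
have : #|rows|%:R + #|~: rows|%:R = n%:R :> R.
  by rewrite -natrD cardsC card_ord.
lra.
Qed.

(* The implied constant c of Omega(n / eps) is uniform in n, eps and the
   algorithm. The range 0 < eps <= eps0 with eps0 < 1/2 arbitrary, and
   n >= 1 / eps, are the regime in which such a bound can hold: for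
   eps >= 1/2 the constant output n / 2 is correct without any read, and
   n / eps exceeds the number n ^ 2 of entries when eps * n < 1. *)
Theorem theorem10 (R : realType) (eps0 : R) (heps0 : eps0 < 1 / 2) :
  exists2 c : R, 0 < c &
    forall (n : nat) (eps : R),
      0 < eps -> eps <= eps0 -> 1 <= eps * n%:R ->
      forall alg : algorithm R n, approximates_psd_spectra eps alg ->
        exists A : 'M[R]_n,
          [/\ binarymx A, psdmx A &
              c * (n%:R / eps) <= #|entries_read alg A|%:R].
Proof.
(* The first bound comes from [identity_reads]; the second from [zero_reads], where [eps > 1 / 6]
   gives [n / eps < 6 * n]. *)
pose c := Num.min (1 / 48) ((1 - 2 * eps0) / 6).
have c_le1 : c <= 1 / 48 by rewrite ge_min lexx.
have c_le2 : c <= (1 - 2 * eps0) / 6 by rewrite ge_min lexx orbT.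
have c_gt0 : 0 < c by rewrite lt_min; apply/andP; split; lra.
exists c => // n eps eps_gt0 eps_le err_ge1 alg approx.
have ratio_ge0 : 0 <= n%:R / eps by rewrite divr_ge0 // ltW.
have [eps_small|eps_big] := leP eps (1 / 6).
  exists (cliquemx R true set0); split.
  - exact: cliquemx_binary.
  - exact: cliquemx_psd.
  have := identity_reads eps_gt0 eps_small err_ge1 approx.
  by have := ler_wpM2r ratio_ge0 c_le1; lra.
exists (cliquemx R false set0); split.
- exact: cliquemx_binary.
- exact: cliquemx_psd.
have err_ge0 : 0 <= eps * n%:R by lra.
apply: le_trans (zero_reads err_ge0 approx).
apply: le_trans (ler_wpM2r ratio_ge0 c_le2) _.
rewrite mulrA ler_pdivrMr //.
have g_ge0 : 0 <= (1 - 2 * eps0) * n%:R by rewrite mulr_ge0 //; lra.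
have g_le : (1 - 2 * eps0) * n%:R <= (1 - 2 * eps) * n%:R.
  by apply: ler_wpM2r => //; lra.
have : (1 - 2 * eps0) * n%:R * (1 / 6) <= (1 - 2 * eps) * n%:R * eps.
  by apply: ler_pM => //; lra.
lra.
Qed.
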